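(* The admissible state set $$\mathcal G=\Big\{\mathbf U=(\rho,\mathbf m,\mathbf B,E)^\top\in\mathbb R^8 \;\Big|\; \rho>0,\ \mathcal E(\mathbf U):=E-\tfrac12\Big(\tfrac{|\mathbf m|^2}{\rho}+|\mathbf B|^2\Big)>0\Big\}$$ is equal to the set $$\mathcal G_*=\Big\{\mathbf U=(\rho,\mathbf m,\mathbf B,E)^\top\in\mathbb R^8 \;\Big|\; \rho>0,\ \mathbf U\cdot\mathbf n^*+\tfrac{|\mathbf B^*|^2}{2}>0\ \ \forall\,\mathbf v^*,\mathbf B^*\in\mathbb R^3\Big\},$$ where, for given $\mathbf v^*,\mathbf B^*\in\mathbb R^3$, $\mathbf n^*=\big(\tfrac{|\mathbf v^*|^2}{2},-\mathbf v^*,-\mathbf B^*,1\big)^\top\in\mathbb R^8$.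
   Context: Vectors $\mathbf U=(\rho,\mathbf m,\mathbf B,E)^\top\in\mathbb R^8$ have $\rho,E\in\mathbb R$ and $\mathbf m,\mathbf B\in\mathbb R^3$ (density, momentum, magnetic field, total energy of ideal magnetohydrodynamics). $|\cdot|$ is the Euclidean norm and $\cdot$ the Euclidean inner product. *)

(* Defs.v *)
From mathcomp Require Import all_boot all_order all_algebra.
From mathcomp Require Import classical_sets reals.
Set Implicit Arguments.
Unset Strict Implicit.
Unset Printing Implicit Defensive.
Import Order.TTheory GRing.Theory Num.Theory.
Local Open Scope ring_scope.
Local Open Scope classical_set_scope.

Definition dot (R : realType) (n : nat) (u v : 'cV[R]_n) : R :=
  \sum_(i < n) u i 0 * v i 0.

(* The library norm on matrices is the sup norm, hence this definition. *)
Definition enorm (R : realType) (n : nat) (u : 'cV[R]_n) : R :=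
  Num.sqrt (dot u u).

(* R^8, with the block sizes of (rho, m, B, E) kept visible for [col_mx],
   [usubmx] and [dsubmx]; the dimension is convertible to 8. *)
Definition state (R : realType) : Type := 'cV[R]_(1 + (3 + (3 + 1))).

Definition mkstate (R : realType) (rho : R) (m B : 'cV[R]_3) (E : R) : state R :=
  col_mx (const_mx rho) (col_mx m (col_mx B (const_mx E))).

Definition density (R : realType) (U : state R) : R := usubmx U 0 0.
Definition momentum (R : realType) (U : state R) : 'cV[R]_3 :=
  usubmx (dsubmx U).
Definition magnetic (R : realType) (U : state R) : 'cV[R]_3 :=
  usubmx (dsubmx (dsubmx U)).
Definition energy (R : realType) (U : state R) : R :=
  dsubmx (dsubmx (dsubmx U)) 0 0.

Lemma mkstateK (R : realType) (rho : R) (m B : 'cV[R]_3) (E : R) :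
  let U := mkstate rho m B E in
  [/\ density U = rho, momentum U = m, magnetic U = B & energy U = E].
Proof.
by rewrite /density /momentum /magnetic /energy !(col_mxKu, col_mxKd) !mxE.
Qed.

Lemma state_eta (R : realType) (U : state R) :
  mkstate (density U) (momentum U) (magnetic U) (energy U) = U.
Proof.
rewrite /mkstate /density /momentum /magnetic /energy.
have c11 (A : 'cV[R]_1) : const_mx (A 0 0) = A.
  by apply/matrixP => i j; rewrite mxE !ord1.
by rewrite !c11 !vsubmxK.
Qed.

Definition internal_energy (R : realType) (U : state R) : R :=
  energy U
  - 2^-1 * (enorm (momentum U) ^+ 2 / density U + enorm (magnetic U) ^+ 2).

Definition nstar (R : realType) (vs Bs : 'cV[R]_3) : state R :=
  mkstate (enorm vs ^+ 2 / 2) (- vs) (- Bs) 1.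

Definition admissible (R : realType) : set (state R) :=
  [set U | 0 < density U /\ 0 < internal_energy U].

Definition admissible_star (R : realType) : set (state R) :=
  [set U | 0 < density U /\
     forall vs Bs : 'cV[R]_3, 0 < dot U (nstar vs Bs) + enorm Bs ^+ 2 / 2].

Arguments admissible R : clear implicits.
Arguments admissible_star R : clear implicits.

(* Main.v *)
Require Import Defs.
From mathcomp Require Import all_boot all_order all_algebra.
From mathcomp Require Import classical_sets reals.
From mathcomp Require Import ring.

(** The function tested in the second description is, for fixed [U] of positive
density, a quadratic polynomial in the two free vectors, and completing the
squares ([dot_nstarE]) turns it into

  internal energy of [U] + (rho / 2) |v* - m / rho|^2 + |B* - B|^2 / 2.

Its minimum over [v*] and [B*] is therefore the internal energy, attained at
the fluid velocity [v* = m / rho] and at the magnetic field [B* = B] of the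
state itself; so the function is positive everywhere exactly when the internal
energy is positive. *)

Set Implicit Arguments.
Unset Strict Implicit.
Unset Printing Implicit Defensive.
Import Order.TTheory GRing.Theory Num.Theory.
Local Open Scope ring_scope.

Section Dot.
Variables (R : realType) (n : nat).
Implicit Types u v : 'cV[R]_n.

Lemma dot_ge0 u : 0 <= dot u u.
Proof. by apply: sumr_ge0 => i _; rewrite -expr2 sqr_ge0. Qed.

Lemma sqr_enorm u : enorm u ^+ 2 = dot u u.
Proof. by rewrite /enorm sqr_sqrtr ?dot_ge0. Qed.

Lemma dotNr u v : dot u (- v) = - dot u v.
Proof. by rewrite /dot -sumrN; apply: eq_bigr => i _; rewrite mxE mulrN. Qed.

Lemma enorm_subZ_sqr a u v :
  enorm (u - a *: v) ^+ 2 = enorm u ^+ 2 - 2 * a * dot v u + a ^+ 2 * enorm v ^+ 2.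
Proof.
rewrite !sqr_enorm /dot !mulr_sumr -sumrB -big_split /=.
by apply: eq_bigr => i _; rewrite !mxE; ring.
Qed.

End Dot.

Lemma dot_col_mx (R : realType) (p q : nat) (u u' : 'cV[R]_p) (v v' : 'cV[R]_q) :
  dot (col_mx u v) (col_mx u' v') = dot u u' + dot v v'.
Proof.
rewrite /dot big_split_ord /=.
by congr (_ + _); apply: eq_bigr => i _; rewrite ?col_mxEu ?col_mxEd.
Qed.

Lemma dot_mkstate (R : realType) (r r' : R) (m m' B B' : 'cV[R]_3) (E E' : R) :
  dot (mkstate r m B E) (mkstate r' m' B' E') =
  r * r' + dot m m' + dot B B' + E * E'.
Proof.
by rewrite /mkstate !dot_col_mx /dot !big_ord1 !mxE !addrA.
Qed.

(** The linear terms [- m . v*] and [- B . B*] are the cross terms of the two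
squares, and the constants left over, [|m|^2 / (2 rho)] and [|B|^2 / 2], are
the kinetic and magnetic energies that [internal_energy] subtracts. *)
Lemma dot_nstarE (R : realType) (U : state R) (vs Bs : 'cV[R]_3) :
  density U != 0 ->
  dot U (nstar vs Bs) + enorm Bs ^+ 2 / 2 =
  internal_energy U
  + density U / 2 * enorm (vs - (density U)^-1 *: momentum U) ^+ 2
  + enorm (Bs - magnetic U) ^+ 2 / 2.
Proof.
move=> rho_neq0; rewrite -[magnetic U in RHS]scale1r !enorm_subZ_sqr.
rewrite -[in LHS](state_eta U) dot_mkstate !dotNr /internal_energy.
by field.
Qed.

Theorem lemma2p2 (R : realType) : admissible R = admissible_star R.
Proof.
apply/seteqP; split=> U [rho_gt0 posU]; split=> //.
  move=> vs Bs; rewrite dot_nstarE ?gt_eqF// -addrA ltr_wpDr//.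
  by rewrite addr_ge0 ?mulr_ge0 ?invr_ge0 ?exprn_ge0 ?sqrtr_ge0 ?ler0n ?(ltW rho_gt0).
have := posU ((density U)^-1 *: momentum U) (magnetic U).
rewrite dot_nstarE ?gt_eqF// !subrr.
have -> : enorm (0 : 'cV[R]_3) ^+ 2 = 0.
  by rewrite sqr_enorm /dot big1 // => i _; rewrite mxE mul0r.
by rewrite mulr0 mul0r !addr0.
Qed.
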